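(* Let $a>0$ and let $\{f_i\}_{i=1}^\infty$ be a sequence with $f_i\in l^2(G_i)$, $\|f_i\|_2\le a$, for groups $G_i$. If $\{f_i\}$ converges in $\hat d$ to $f\in l^2(G)$, then $f$ is isomorphic to $\lim_\omega f_i$ (a function on the ultraproduct group $\prod_\omega G_i$) for every non-principal ultrafilter $\omega$ on $\mathbb{N}$. Consequently, such a sequence $\{f_i\}$ is convergent in $\hat d$ if and only if the isomorphism class of $\lim_\omega f_i$ does not depend on the choice of the non-principal ultrafilter $\omega$.
   Context: For a group $G$, $l^2(G)$ is the set of $f:G\to\mathbb{C}$ with $\|f\|_2^2=\sum_g|f(g)|^2<\infty$ (so $|f_i|\le a$ pointwise). ${\rm supp}_\epsilon(f)=\{g:|f(g)|>\epsilon\}$, ${\rm supp}(f)={\rm supp}_0(f)$, $\langle f\rangle$ the subgroup generated by ${\rm supp}(f)$. $f_1\in l^2(G_1),f_2\in l^2(G_2)$ are isomorphic if there is an isomorphism $\alpha:\langle f_1\rangle\to\langle f_2\rangle$ with $f_1=f_2\circ\alpha$. A partial isomorphism of weight $n$ is a bijection $\phi:S_1\to S_2$ ($S_j\subseteq G_j$) such that for all $g_1,\dots,g_n\in S_1$, $\alpha_i\in\{-1,0,1\}$: $g_1^{\alpha_1}\cdots g_n^{\alpha_n}=1$ iff $\phi(g_1)^{\alpha_1}\cdots\phi(g_n)^{\alpha_n}=1$. An $\epsilon$-isomorphism between $f_1,f_2$ is a partial isomorphism $\phi:S_1\to S_2$ of weight $\lceil1/\epsilon\rceil$ with ${\rm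 supp}_\epsilon(f_j)\subseteq S_j$ and $|f_1(g)-f_2(\phi(g))|\le\epsilon$ on $S_1$; $\hat d(f_1,f_2)$ is the infimum of such $\epsilon$. The ultraproduct group $\prod_\omega G_i$ consists of sequences $(x_i)$, $x_i\in G_i$, modulo agreement on a set in $\omega$, and $\lim_\omega f_i$ is the function whose value at the class of $(x_i)$ is the ultralimit $\lim_\omega f_i(x_i)$ in the closed disc of radius $a$. *)

(* Defs.v *)
From HB Require Import structures.
From mathcomp Require Import all_boot all_order all_algebra.
From mathcomp Require Import all_classical all_reals all_analysis.
From mathcomp Require Import complex.

Set Implicit Arguments.
Unset Strict Implicit.
Unset Printing Implicit Defensive.

Import Order.TTheory GRing.Theory Num.Theory.
Import numFieldNormedType.Exports.
Import Normc.

Local Open Scope classical_set_scope.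
Local Open Scope ring_scope.

Section L2.
Context {R : realType} {G : groupType}.
Implicit Type f : G -> R[i].

Definition sqnorm2 f : \bar R := \esum_(g in [set: G]) (normc (f g) ^+ 2)%:E.

Definition l2 : set (G -> R[i]) := [set f | (sqnorm2 f < +oo)%E].

Definition norm2 f : R := Num.sqrt (fine (sqnorm2 f)).

Definition supp_eps (e : R) f : set G := [set g | e < normc (f g)].

Definition supp f : set G := supp_eps 0 f.

End L2.

Section Subgroup.
Context {G : groupType}.

Definition is_subgroup (H : set G) :=
  [/\ H 1%g, forall x y, H x -> H y -> H (x * y)%g & forall x, H x -> H x^-1%g].

Definition generated (S : set G) : set G := smallest is_subgroup S.

Definition expgz (x : G) (m : int) : G :=
  match m with Posz n => (x ^+ n)%g | Negz n => (x ^- n.+1)%g end.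

End Subgroup.

Section Isomorphism.
Context {R : realType} {G1 G2 : groupType}.

(* Maps between subsets of the groups are total functions, of which only the
   restriction to the source subset matters. *)
Definition isomorphic (f1 : G1 -> R[i]) (f2 : G2 -> R[i]) :=
  exists alpha : G1 -> G2,
  [/\ set_bij (generated (supp f1)) (generated (supp f2)) alpha,
      {in generated (supp f1) &, {morph alpha : x y / (x * y)%g}}
    & {in generated (supp f1), f1 =1 f2 \o alpha}].

Definition partial_iso (n : nat) (S1 : set G1) (S2 : set G2) (phi : G1 -> G2) :=
  set_bij S1 S2 phi /\
  forall (g : 'I_n -> G1) (alpha : 'I_n -> int),
    (forall i, S1 (g i)) -> (forall i, alpha i \in [:: -1; 0; 1]) ->
    (\prod_(i < n) expgz (g i) (alpha i) = 1)%g <->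
    (\prod_(i < n) expgz (phi (g i)) (alpha i) = 1)%g.

Definition eps_iso (e : R) (f1 : G1 -> R[i]) (f2 : G2 -> R[i]) :=
  exists (S1 : set G1) (S2 : set G2) (phi : G1 -> G2),
  [/\ partial_iso `|Num.ceil e^-1|%N S1 S2 phi,
      supp_eps e f1 `<=` S1, supp_eps e f2 `<=` S2
    & forall g, S1 g -> normc (f1 g - f2 (phi g)) <= e].

(* The set below is never empty for l2 functions: a large e admits the empty
   partial isomorphism.  Hence inf is the genuine infimum. *)
Definition dhat (f1 : G1 -> R[i]) (f2 : G2 -> R[i]) : R :=
  inf [set e | 0 < e /\ eps_iso e f1 f2].

End Isomorphism.

Record ultrafilter_on (T : Type) := UltrafilterOn {
  ultrafilter_sets :> (T -> Prop) -> Prop;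
  ultrafilter_class : UltraFilter ultrafilter_sets }.

#[global] Existing Instance ultrafilter_class.

Definition nonprincipal (T : Type) (w : ultrafilter_on T) :=
  forall x, w <> principal_filter x :> set_system T.

Section Ultraproduct.
Variables (w : ultrafilter_on nat) (G : nat -> groupType).
Implicit Types x y : forall i, G i.

Definition ueq x y : bool := `[< w [set i | x i = y i] >].

Lemma ueq_equiv : equiv_class_of ueq.
Proof.
split=> [x|x y|y x z].
- by apply/asboolP; apply: filterE.
- by apply/asboolP/asboolP; apply: filterS => i /= ->.
- move=> /asboolP xy /asboolP yz; apply/asboolP.
  by apply: filterS2 xy yz => i /= -> ->.
Qed.

Canonical ueq_equiv_rel := EquivRelPack ueq_equiv.

Definition ultraprod : Type := {eq_quot ueq}%qT.

HB.instance Definition _ := Choice.on ultraprod.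
HB.instance Definition _ := EqQuotient.on ultraprod.

Definition upi x : ultraprod := \pi_ultraprod%qT x.
Definition urepr (X : ultraprod) : forall i, G i := repr X.

Lemma upiP x y : upi x = upi y <-> w [set i | x i = y i].
Proof. by split=> [/eqmodP/asboolP|/asboolP xy]; last exact/eqmodP. Qed.

Lemma upiK (X : ultraprod) : upi (urepr X) = X.
Proof. exact: reprK. Qed.

Definition umul (X Y : ultraprod) :=
  upi (fun i => urepr X i * urepr Y i)%g.
Definition uone := upi (fun i => 1%g).
Definition uinv (X : ultraprod) := upi (fun i => (urepr X i)^-1%g).

Lemma upiM x y : umul (upi x) (upi y) = upi (fun i => x i * y i)%g.
Proof.
apply/upiP.
have /upiP xE := upiK (upi x); have /upiP yE := upiK (upi y).
by apply: filterS2 xE yE => i /= -> ->.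
Qed.

Lemma upiV x : uinv (upi x) = upi (fun i => (x i)^-1%g).
Proof.
by apply/upiP; have /upiP := upiK (upi x); apply: filterS => i /= ->.
Qed.

Lemma umulA : associative umul.
Proof.
move=> X Y Z; rewrite -(upiK X) -(upiK Y) -(upiK Z) !upiM.
by apply/upiP; apply: filterE => i /=; rewrite mulgA.
Qed.

Lemma umul1 : left_id uone umul.
Proof.
by move=> X; rewrite -(upiK X) upiM; apply/upiP/filterE => i /=; rewrite mul1g.
Qed.

Lemma umulr1 : right_id uone umul.
Proof.
by move=> X; rewrite -(upiK X) upiM; apply/upiP/filterE => i /=; rewrite mulg1.
Qed.

Lemma umulV : left_inverse uone uinv umul.
Proof.
move=> X; rewrite -(upiK X) upiV upiM; apply/upiP/filterE => i /=.
by rewrite mulVg.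
Qed.

Lemma umulrV : right_inverse uone uinv umul.
Proof.
move=> X; rewrite -(upiK X) upiV upiM; apply/upiP/filterE => i /=.
by rewrite mulgV.
Qed.

HB.instance Definition _ :=
  isGroup.Build ultraprod umulA umul1 umulr1 umulV umulrV.

(* The regular algebra R[i]^o carries the usual topology of the complex numbers,
   and ulimE shows that the choice of representative is irrelevant. *)
Definition ulim (R : realType) (f : forall i, G i -> R[i]) (X : ultraprod) :
  R[i] :=
  lim ((fun i => f i (urepr X i) : R[i]^o) @ (w : set_system nat)).

Lemma ulimE (R : realType) (f : forall i, G i -> R[i]) x :
  ulim f (upi x) = lim ((fun i => f i (x i) : R[i]^o) @ (w : set_system nat)).
Proof.
apply: (congr1 (@lim R[i]^o)).
have /upiP xE := upiK (upi x).
apply/funext => A; apply/propext; split;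
  by apply: filterS2 xE => i /= ->.
Qed.
End Ultraproduct.

Arguments ulim w {G R} f X.

(* Main.v *)
(** Every non-principal ultralimit sees a dhat-convergent sequence in the same
    way.  If the e_i-isomorphisms between f_i and h have e_i -> 0, then sending
    t in supp h to the class of its partners in the G_i identifies words in
    supp h with words in the ultraproduct; it is onto the support of the
    ultralimit because supp_d h is finite for d > 0, so that an ultrafilter
    selects a single partner.  Conversely, an isomorphism from h onto the
    ultralimit restricts to the finite set supp_{e/2} h, where only finitely
    many words of bounded length have to be compared, and so gives an
    e-isomorphism with f_i for w-many i.  If all ultralimits are isomorphic, take
    for h one of them, which is in l2 by a Fatou argument: the set of i with an
    e-isomorphism between f_i and h belongs to every non-principal ultrafilter,
    hence is cofinite. *)

Require Import Defs.
From HB Require Import structures.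
From mathcomp Require Import all_boot all_order all_algebra.
From mathcomp Require Import all_classical all_reals all_analysis.
From mathcomp Require Import complex ring lra.

Set Implicit Arguments.
Unset Strict Implicit.
Unset Printing Implicit Defensive.

Import Order.TTheory GRing.Theory Num.Theory.
Import numFieldNormedType.Exports.
Import Normc.

Local Open Scope classical_set_scope.
Local Open Scope ring_scope.

(** * Bijections between subsets, words and generated subgroups *)

Lemma set_bij_inverse (A B : groupType) (S : set A) (T : set B) (f : A -> B) :
  set_bij S T f ->
  exists g : B -> A,
    [/\ set_bij T S g, forall x, S x -> g (f x) = x
      & forall y, T y -> f (g y) = y].
Proof.
move=> bf; have [ff fi fs] := bf.
exists ('pinv_(fun=> 1%g) S f); split; first exact: bijpinv_bij.
- by move=> x Sx; apply: pinvKV => //; apply/mem_set.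
- by move=> y /fs Ty; apply: pinvK; apply/mem_set.
Qed.

Section Words.
Context {G1 G2 : groupType}.
Implicit Types (S : set G1) (l : seq (G1 * int)) (phi : G1 -> G2).

(** A letter is a group element with an exponent. The exponent 0 is allowed as in [partial_iso], so
    that short words can be padded to a given length. *)
Definition word_in (G : groupType) (S : set G) (l : seq (G * int)) :=
  forall p, p \in l -> S p.1 /\ p.2 \in [:: -1; 0; 1].

Definition word_inv (G : groupType) (l : seq (G * int)) :=
  rev [seq (p.1, - p.2) | p <- l].

(** The word is evaluated after [phi] has been applied to each letter, so [phi] need not be
    multiplicative; [word_val id] is the value in the source group. *)
Definition word_val (phi : G1 -> G2) (l : seq (G1 * int)) : G2 :=
  (\prod_(p <- l) expgz (phi p.1) p.2)%g.

Lemma expgz_opp (x : G2) (m : int) : expgz x (- m) = (expgz x m)^-1%g.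
Proof. by case: m => [[|n]|n] //=; rewrite ?invg1 ?invgK. Qed.

Lemma word_val_cons phi p l :
  word_val phi (p :: l) = (expgz (phi p.1) p.2 * word_val phi l)%g.
Proof. by rewrite /word_val big_cons. Qed.

Lemma word_val_cat phi l l' :
  word_val phi (l ++ l') = (word_val phi l * word_val phi l')%g.
Proof. by rewrite /word_val big_cat. Qed.

Lemma word_val_inv phi l : word_val phi (word_inv l) = (word_val phi l)^-1%g.
Proof.
elim: l => [|p l IH]; first by rewrite /word_val !big_nil invg1.
rewrite /word_inv map_cons rev_cons -cats1 word_val_cat -/(word_inv l) IH.
by rewrite !word_val_cons /= expgz_opp /word_val big_nil mulg1 invgM.
Qed.

Lemma word_in_cat S l l' : word_in S l -> word_in S l' -> word_in S (l ++ l').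
Proof. by move=> Sl Sl' p; rewrite mem_cat => /orP[/Sl|/Sl']. Qed.

Lemma word_in_inv S l : word_in S l -> word_in S (word_inv l).
Proof.
move=> Sl p; rewrite mem_rev => /mapP[q /Sl[Sq q2] ->]; split=> //=.
by move: q2; rewrite !inE => /or3P[] /eqP ->.
Qed.

(** Equality of two words becomes triviality of a single one, the only kind of relation that partial
    isomorphisms compare. *)
Lemma word_val_eq phi l l' : word_val phi l = word_val phi l' <->
  word_val phi (l ++ word_inv l') = 1%g.
Proof.
rewrite word_val_cat word_val_inv; split=> [->|]; first by rewrite mulgV.
exact: divg1_eq.
Qed.

Lemma eq_word_val phi phi' l :
  (forall p, p \in l -> phi p.1 = phi' p.1) -> word_val phi l = word_val phi' l.
Proof. by move=> e; apply: eq_big_seq => p /e ->. Qed.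

End Words.

Lemma generated_subgroup (G : groupType) (S : set G) : is_subgroup (generated S).
Proof.
split=> [A [[]]|x y Sx Sy A AP|x Sx A AP] //.
- by case: (AP) => -[_ AM _] _; apply: AM; [exact: Sx|exact: Sy].
- by case: (AP) => -[_ _ AV] _; apply: AV; exact: Sx.
Qed.

Lemma sub_generated (G : groupType) (S : set G) : S `<=` generated S.
Proof. by move=> x Sx A [_]; apply. Qed.

(** The values of words form a subgroup containing [S], and any subgroup containing [S] contains
    them by induction on the word. *)
Lemma generated_word (G : groupType) (S : set G) (x : G) :
  generated S x <-> exists2 l, word_in S l & word_val id l = x.
Proof.
split=> [Sx|[l Sl <-]].
  apply: (Sx [set y | exists2 l, word_in S l & word_val id l = y]).
  split; first split.
  - by exists [::] => //; rewrite /word_val big_nil.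
  - move=> _ _ [l Sl <-] [l' Sl' <-].
    by exists (l ++ l'); [exact: word_in_cat|rewrite word_val_cat].
  - move=> _ [l Sl <-].
    by exists (word_inv l); [exact: word_in_inv|rewrite word_val_inv].
  - move=> y Sy; exists [:: (y, 1)]; first by move=> p; rewrite inE => /eqP ->.
    by rewrite word_val_cons /word_val big_nil mulg1 /= expg1.
have [S1 SM SV] := generated_subgroup S.
elim: l Sl => [|p l IH] Sl; first by rewrite /word_val big_nil.
rewrite word_val_cons; apply: (SM); last first.
  by apply: IH => q ql; apply: Sl; rewrite inE ql orbT.
have [/sub_generated Sp p2] : _ := Sl p (mem_head _ _).
by move: p2; rewrite !inE => /or3P[] /eqP -> /=; rewrite ?expg1 //; apply: SV.
Qed.

Section MorphismWords.
Context {G1 G2 : groupType} (S : set G1) (alpha : G1 -> G2).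
Hypothesis alphaM :
  {in generated S &, {morph alpha : x y / (x * y)%g}}.

Lemma morph_generated1 : alpha 1%g = 1%g.
Proof.
have [S1 _ _] := generated_subgroup S.
apply: (mulgI (alpha 1%g)); rewrite mulg1 -[in RHS](mulg1 1%g).
by rewrite -alphaM ?mulg1 //; apply/mem_set.
Qed.

Lemma morph_generatedV x : generated S x -> alpha x^-1%g = (alpha x)^-1%g.
Proof.
have [S1 _ SV] := generated_subgroup S; move=> Sx.
apply: (mulgI (alpha x)); rewrite mulgV -alphaM ?mulgV ?morph_generated1 //.
  exact/mem_set.
by apply/mem_set; exact: SV.
Qed.

Lemma morph_generated_word l :
  word_in S l -> alpha (word_val id l) = word_val alpha l.
Proof.
elim: l => [|p l IH] Sl; first by rewrite /word_val !big_nil morph_generated1.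
have Sl' : word_in S l by move=> q ql; apply: Sl; rewrite inE ql orbT.
have [Sp p2] : _ := Sl p (mem_head _ _).
have wp : word_in S [:: p] by move=> q; rewrite inE => /eqP ->.
rewrite !word_val_cons alphaM -?IH //; last first.
- by apply/mem_set/generated_word; exists l.
- apply/mem_set/generated_word; exists [:: p] => //.
  by rewrite /word_val big_seq1.
congr (_ * _)%g; move: p2; rewrite !inE => /or3P[] /eqP -> /=.
- by rewrite !expg1 morph_generatedV //; exact: sub_generated.
- exact: morph_generated1.
- by [].
Qed.

End MorphismWords.

(** The extension sends the value of a word to the value of its image under [beta]. Since both
    directions of the hypothesis transfer equality of words, this is well defined and injective. *)
Lemma word_iso_extends (G1 G2 : groupType) (S1 : set G1) (S2 : set G2)
    (beta : G1 -> G2) :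
  beta @` S1 = S2 ->
  (forall l, word_in S1 l -> word_val id l = 1%g <-> word_val beta l = 1%g) ->
  exists alpha : G1 -> G2,
    [/\ set_bij (generated S1) (generated S2) alpha,
        {in generated S1 &, {morph alpha : x y / (x * y)%g}}
      & forall x, S1 x -> alpha x = beta x].
Proof.
move=> bS betaP.
have betaE l l' : word_in S1 l -> word_in S1 l' ->
    word_val id l = word_val id l' <-> word_val beta l = word_val beta l'.
  move=> Sl Sl'; rewrite !word_val_eq.
  by apply: betaP; apply: word_in_cat => //; exact: word_in_inv.
(* The value at [x] is read off from some word for [x]; outside the generated subgroup any value
   will do. *)
have /choice[alpha alphaP] (x : G1) : exists y, generated S1 x ->
    exists l, [/\ word_in S1 l, word_val id l = x & word_val beta l = y].
  have [/generated_word[l Sl <-]|nx] := pselect (generated S1 x).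
    by exists (word_val beta l) => _; exists l.
  by exists 1%g.
have alphaE l : word_in S1 l -> alpha (word_val id l) = word_val beta l.
  move=> Sl; have [|l' [Sl' ll' <-]] := alphaP (word_val id l).
    by apply/generated_word; exists l.
  exact/betaE.
exists alpha; split.
- split.
  + move=> _ /generated_word[l Sl <-]; rewrite alphaE //.
    apply/generated_word; exists [seq (beta p.1, p.2) | p <- l].
      move=> _ /mapP[p /Sl[Sp p2] ->]; split=> //=.
      by rewrite -bS; exists p.1.
    by rewrite /word_val big_map.
  + move=> x y /set_mem/generated_word[l Sl <-].
    move=> /set_mem/generated_word[l' Sl' <-].
    by rewrite !alphaE // => /betaE; apply.
  + move=> _ /generated_word[l Sl <-].
    (* A word in [S2] is lifted letter by letter along [beta]. *)
    have [l' [Sl' <-]] : exists l', word_in S1 l' /\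
        [seq (beta p.1, p.2) | p <- l'] = l.
      elim: l Sl => [|[y m] l IH] Sl; first by exists [::].
      have [|l' [Sl' <-]] := IH.
        by move=> q ql; apply: Sl; rewrite inE ql orbT.
      have [/= + m2] := Sl _ (mem_head _ _).
      rewrite -bS => -[x Sx <-]; exists ((x, m) :: l'); split=> // p.
      by rewrite inE => /predU1P[->//|/Sl'].
    exists (word_val id l'); first by apply/generated_word; exists l'.
    by rewrite alphaE // /word_val big_map.
- move=> x y /set_mem/generated_word[l Sl <-].
  move=> /set_mem/generated_word[l' Sl' <-].
  by rewrite -word_val_cat !alphaE // ?word_val_cat //; exact: word_in_cat.
- move=> x Sx; have w1 : word_in S1 [:: (x, 1)].
    by move=> p; rewrite inE => /eqP ->.
  by have := alphaE _ w1; rewrite /word_val !big_seq1 /= !expg1.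
Qed.

(** * Isomorphism of functions as an equivalence *)

Section IsomorphicFunctions.
Context {R : realType}.

Lemma supp_neq0 (G : groupType) (f : G -> R[i]) x : supp f x <-> f x != 0.
Proof.
rewrite /supp /supp_eps /=; split=> [|fx0].
  by apply: contraTneq => ->; rewrite normc0 ltxx.
rewrite lt_neqAle; apply/andP; split.
  by rewrite eq_sym; apply: contra fx0 => /eqP/eq0_normc ->.
by case: (f x) => ? ?; exact: sqrtr_ge0.
Qed.

Lemma isomorphic_word (G1 G2 : groupType) (f1 : G1 -> R[i]) (f2 : G2 -> R[i])
    (beta : G1 -> G2) :
  beta @` supp f1 = supp f2 ->
  (forall l, word_in (supp f1) l ->
     word_val id l = 1%g <-> word_val beta l = 1%g) ->
  (forall x, supp f1 x -> f1 x = f2 (beta x)) ->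
  isomorphic f1 f2.
Proof.
move=> bS betaP f12; have [alpha [alpha_bij alphaM alphaE]] :=
  word_iso_extends bS betaP.
exists alpha; split=> // x /set_mem Sx /=.
have [sx|nsx] := pselect (supp f1 x); first by rewrite alphaE // f12.
have /eqP -> : f1 x == 0 by apply/negPn/negP => /supp_neq0.
(* If [f2] did not vanish at [alpha x], then [alpha x] would equal [alpha y] for some [y] in the
   support of [f1], and injectivity would put [x] there too. *)
apply/esym/eqP/negPn/negP => /supp_neq0; rewrite -bS => -[y sy].
rewrite -alphaE // => yx; apply: nsx; have [_ inj _] := alpha_bij.
by rewrite -(inj _ _ _ _ yx) //; apply/mem_set => //; exact: sub_generated.
Qed.

Lemma isomorphic_sym (G1 G2 : groupType) (f1 : G1 -> R[i]) (f2 : G2 -> R[i]) :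
  isomorphic f1 f2 -> isomorphic f2 f1.
Proof.
move=> [alpha [alpha_bij alphaM f12]].
have [g [g_bij alphaK gK]] := set_bij_inverse alpha_bij.
have [gf _ _] := g_bij.
have gin x : generated (supp f2) x -> g x \in generated (supp f1).
  by move=> Sx; apply/mem_set; exact: gf.
exists g; split=> // [x y /set_mem Sx /set_mem Sy|x /set_mem Sx /=].
  rewrite -{1}(gK x) // -{1}(gK y) // -alphaM ?gin //.
  have [_ SM _] := generated_subgroup (supp f1).
  by rewrite alphaK //; apply: SM; exact: gf.
by rewrite (f12 (g x)) /= ?gK ?gin.
Qed.

Lemma isomorphic_trans (G1 G2 G3 : groupType) (f1 : G1 -> R[i])
    (f2 : G2 -> R[i]) (f3 : G3 -> R[i]) :
  isomorphic f1 f2 -> isomorphic f2 f3 -> isomorphic f1 f3.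
Proof.
move=> [al [al_bij alM f12]] [be [be_bij beM f23]].
have [alf _ _] := al_bij.
have als x : x \in generated (supp f1) -> al x \in generated (supp f2).
  by move=> /set_mem Sx; apply/mem_set; exact: alf.
exists (be \o al); split; first exact: set_bij_comp al_bij be_bij.
  by move=> x y Sx Sy /=; rewrite alM // beM //; exact: als.
by move=> x Sx /=; rewrite f12 //= f23 //; exact: als.
Qed.

End IsomorphicFunctions.

(** * Partial isomorphisms in terms of words *)

Section PartialIsomorphisms.
Context {G1 G2 : groupType}.
Implicit Types (S : set G1) (T : set G2) (phi : G1 -> G2).

(** Letters with exponent 0 do not change the value, so comparing words of length exactly [n]
    amounts to comparing all words of length at most [n]. *)
Lemma partial_iso_wordP n S T phi :
  partial_iso n S T phi <->
  set_bij S T phi /\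
  forall l, word_in S l -> (size l <= n)%N ->
    word_val id l = 1%g <-> word_val phi l = 1%g.
Proof.
split=> -[bij phiP]; split=> //.
  move=> [|p0 l0]; first by rewrite /word_val !big_nil.
  set l := p0 :: l0 => Sl ln.
  (* Padding needs an element of [S]; the first letter provides one, the empty word having been
     settled before. *)
  pose pad := nseq (n - size l) (p0.1, 0 : int).
  have padE (G : groupType) (h : G1 -> G) :
      word_val h (l ++ pad) = word_val h l.
    rewrite word_val_cat [word_val h pad]big1_seq ?mulg1 //.
    by move=> p /= /nseqP[-> _].
  have Slp : word_in S (l ++ pad).
    apply: word_in_cat => // p /nseqP[-> _] /=; split=> //.
    by have [] := Sl p0 (mem_head _ _).
  have sz : size (l ++ pad) = n by rewrite size_cat size_nseq subnKC.
  rewrite -!padE {ln padE}; move: (l ++ pad) sz Slp => s sz Ss.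
  subst n; rewrite /word_val 2!(big_tnth _ _ s); apply: phiP => i.
    by have [] := Ss _ (mem_tnth i (in_tuple s)).
  by have [] := Ss _ (mem_tnth i (in_tuple s)).
move=> g al Sg al1.
have := phiP [seq (g i, al i) | i <- index_enum 'I_n].
rewrite /word_val !big_map /=; apply.
  by move=> _ /mapP[i _ ->] /=; split.
by rewrite size_map [index_enum _]unlock -enumT size_enum_ord.
Qed.

Lemma partial_iso_le m n S T phi :
  (m <= n)%N -> partial_iso n S T phi -> partial_iso m S T phi.
Proof.
move=> mn /partial_iso_wordP[bij phiP]; apply/partial_iso_wordP; split=> //.
by move=> l Sl lm; apply: phiP => //; exact: leq_trans mn.
Qed.

End PartialIsomorphisms.

Lemma partial_iso_sym (G1 G2 : groupType) n (S : set G1) (T : set G2) phi psi :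
  set_bij T S psi -> (forall y, T y -> phi (psi y) = y) ->
  partial_iso n S T phi -> partial_iso n T S psi.
Proof.
move=> bij psiK [_ phiP]; have [psif _ _] := bij; split=> // g al Tg al1.
rewrite (phiP (psi \o g)) //; last by move=> i; exact: psif.
by under [in X in _ <-> X]eq_bigr => i _ do rewrite /= psiK //.
Qed.

(** * Properties of e-isomorphisms, square-summable functions and [dhat] *)

Section EpsIsomorphisms.
Context {R : realType}.
Implicit Types e : R.

Lemma normc_ge0 (z : R[i]) : 0 <= normc z.
Proof. by case: z => ? ?; exact: sqrtr_ge0. Qed.

Lemma normcN (z : R[i]) : normc (- z) = normc z.
Proof. by case: z => x y /=; rewrite !sqrrN. Qed.

Lemma normcBC (y z : R[i]) : normc (y - z) = normc (z - y).
Proof. by rewrite -normcN opprB. Qed.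

Lemma le_normc_dist (y z : R[i]) : normc y - normc z <= normc (y - z).
Proof. by rewrite lerBlDr -{1}(subrK z y) le_normcD. Qed.

(** Every condition weakens as [e] grows: the required weight drops and the sets [supp_eps]
    shrink. *)
Lemma eps_iso_le (G1 G2 : groupType) e e' (f1 : G1 -> R[i]) (f2 : G2 -> R[i]) :
  0 < e -> e <= e' -> eps_iso e f1 f2 -> eps_iso e' f1 f2.
Proof.
move=> e0 ee' [S [T [phi [phiP S1 T1 fphi]]]].
have e'0 : 0 < e' by exact: lt_le_trans ee'.
exists S, T, phi; split.
- apply: partial_iso_le phiP; rewrite -lez_nat.
  rewrite !gez0_abs ?le_ceil ?lef_pV2 ?posrE //.
  + by rewrite -(ceil0 R) le_ceil // invr_ge0 ltW.
  + by rewrite -(ceil0 R) le_ceil // invr_ge0 ltW.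
- by apply: subset_trans S1 => x; exact: le_lt_trans.
- by apply: subset_trans T1 => x; exact: le_lt_trans.
- by move=> x /fphi /le_trans; apply.
Qed.

Lemma eps_iso_sym (G1 G2 : groupType) e (f1 : G1 -> R[i]) (f2 : G2 -> R[i]) :
  eps_iso e f1 f2 -> eps_iso e f2 f1.
Proof.
move=> [S [T [phi [phiP S1 T1 fphi]]]]; have [bij _] := phiP.
have [psi [psi_bij phiK psiK]] := set_bij_inverse bij.
have [psif _ _] := psi_bij.
exists T, S, psi; split=> //; first exact: partial_iso_sym phiP.
by move=> y Ty; rewrite normcBC -{2}(psiK y) //; exact/fphi/psif.
Qed.

Lemma l2_normc_le (G : groupType) (f : G -> R[i]) x :
  l2 f -> normc (f x) <= norm2 f.
Proof.
rewrite /l2 /= => fl2.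
have le1 : ((normc (f x) ^+ 2)%:E <= sqnorm2 f)%E.
  apply: esum_ge; exists [set x]; last by rewrite fsbig_set1.
  by split=> //; exact: finite_set1.
have fin : sqnorm2 f \is a fin_num.
  by rewrite ge0_fin_numE // (le_trans _ le1) // lee_fin exprn_ge0 ?normc_ge0.
rewrite -(ler_pXn2r (n := 2)) ?nnegrE ?normc_ge0 ?sqrtr_ge0 //.
rewrite sqr_sqrtr; first by rewrite -lee_fin fineK.
by rewrite fine_ge0 // (le_trans _ le1) // lee_fin exprn_ge0 ?normc_ge0.
Qed.

(** Chebyshev's inequality: each point of [supp_eps e f] contributes at least [e ^+ 2] to the square
    norm, so there can be at most [c] of them. *)
Lemma l2_finite_supp_eps (G : groupType) (f : G -> R[i]) e :
  l2 f -> 0 < e -> finite_set (supp_eps e f).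
Proof.
move=> fl2 e0; apply/not_notP => inf.
have ge0 (x : G) : (0 <= (normc (f x) ^+ 2)%:E)%E.
  by rewrite lee_fin exprn_ge0 ?normc_ge0.
have fin : sqnorm2 f \is a fin_num.
  by rewrite ge0_fin_numE // esum_ge0.
pose c := fine (sqnorm2 f) / e ^+ 2.
have [B BA nB] := infinite_set_fset (Num.truncn c).+1 inf.
have : ((e ^+ 2 *+ size (finmap.enum_fset B))%:E <= sqnorm2 f)%E.
  apply: esum_ge; exists [set` finmap.enum_fset B].
    by split=> //; exact: finite_seq.
  rewrite -fsbig_seq ?finmap.fset_uniq //.
  rewrite sumEFin lee_fin -sum1_size -sumrMnr /= !big_seq.
  apply: ler_sum => x Bx.
  rewrite mulr1n ler_pXn2r ?nnegrE ?normc_ge0 ?(ltW e0) //.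
  by apply: ltW; exact: BA.
rewrite -(fineK fin) lee_fin leNgt => /negP; apply.
rewrite -mulr_natl -ltr_pdivrMr ?exprn_gt0 //.
by apply: lt_le_trans (truncnS_gt _) _; rewrite ler_nat.
Qed.

Lemma dhat_set_nonempty (G1 G2 : groupType) (f1 : G1 -> R[i])
    (f2 : G2 -> R[i]) :
  l2 f1 -> l2 f2 -> [set e | 0 < e /\ eps_iso e f1 f2] !=set0.
Proof.
(* This exceeds both norms, hence all values of both functions, so both sets [supp_eps] are empty;
   the summand 1 makes it positive. *)
move=> l1 l2; pose e : R := norm2 f1 + norm2 f2 + 1.
have n1 : 0 <= norm2 f1 by exact: sqrtr_ge0.
have n2 : 0 <= norm2 f2 by exact: sqrtr_ge0.
have e0 : 0 < e by rewrite ltr_wpDl // addr_ge0.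
exists e; split=> //; exists set0, set0, (fun=> 1%g); split=> //.
- split; first by split=> // x; rewrite in_set0.
  move=> g al Sg _; case: `|_|%N g al Sg => [|n] g al Sg.
    by rewrite !big_ord0.
  by have := Sg ord0.
- move=> x; rewrite /supp_eps /= ltNge (le_trans (l2_normc_le x l1)) //.
  by rewrite /e -addrA lerDl addr_ge0.
- move=> x; rewrite /supp_eps /= ltNge (le_trans (l2_normc_le x l2)) //.
  by rewrite /e addrAC lerDr addr_ge0.
Qed.

Lemma dhat_ge0 (G1 G2 : groupType) (f1 : G1 -> R[i]) (f2 : G2 -> R[i]) :
  0 <= dhat f1 f2.
Proof.
rewrite /dhat.
(* The infimum of the empty set is 0 by convention. *)
have [->|/set0P ne] := eqVneq [set e | 0 < e /\ eps_iso e f1 f2] set0.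
  by rewrite inf0.
by apply: lb_le_inf => // e [/ltW].
Qed.

Lemma dhat_le (G1 G2 : groupType) e (f1 : G1 -> R[i]) (f2 : G2 -> R[i]) :
  0 < e -> eps_iso e f1 f2 -> dhat f1 f2 <= e.
Proof. by move=> e0 fe; apply: ge_inf => //; exists 0 => x [/ltW]. Qed.

(** Some admissible value lies strictly below [e], and monotonicity carries its isomorphism up to
    [e]. *)
Lemma eps_iso_dhat (G1 G2 : groupType) e (f1 : G1 -> R[i]) (f2 : G2 -> R[i]) :
  l2 f1 -> l2 f2 -> dhat f1 f2 < e -> eps_iso e f1 f2.
Proof.
move=> l1 l2 de; have [||e' [e'0 fe'] e'e] := @inf_adherent _
    [set e | 0 < e /\ eps_iso e f1 f2] (e - dhat f1 f2).
- by rewrite subr_gt0.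
- split; first exact: dhat_set_nonempty.
  by exists 0 => x [/ltW].
- by apply: eps_iso_le fe' => //; rewrite ltW //; rewrite /dhat addrC subrK in e'e.
Qed.

End EpsIsomorphisms.

(** * Ultrafilters and cofinite sets *)

Section Filters.

Lemma filter_seq (I : Type) (F : set_system I) {FF : Filter F}
    (U : eqType) (s : seq U) (P : U -> set I) :
  (forall x, x \in s -> F (P x)) -> F [set i | forall x, x \in s -> P x i].
Proof.
elim: s => [|x s IH] Ps; first exact: filterE.
have Px : F (P x) by apply: Ps; exact: mem_head.
have Ps' : F [set i | forall y, y \in s -> P y i].
  by apply: IH => y ys; apply: Ps; rewrite inE ys orbT.
apply: filterS2 Px Ps' => i Pxi Psi y.
by rewrite inE => /predU1P[->//|]; exact: Psi.
Qed.

(** Otherwise [w] contains the complement of each [P x], and these finitely many complements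
    together exclude the given set. *)
Lemma ultra_pigeonhole (I : Type) (w : ultrafilter_on I) (U : eqType)
    (s : seq U) (P : U -> set I) :
  w [set i | exists2 x, x \in s & P x i] -> exists2 x, x \in s & w (P x).
Proof.
move=> wP; apply/not_notP => nP.
have wn : w [set i | forall x, x \in s -> ~ P x i].
  apply: filter_seq => // x xs.
  have [wPx|//] := in_ultra_setVsetC (P x) (ultrafilter_class w).
  by case: nP; exists x.
have : w set0 by apply: filterS2 wP wn => i [x xs Pxi] /(_ x xs).
exact: filter_not_empty.
Qed.

(** An ultrafilter containing a singleton is principal, so [w] contains all complements of
    singletons; finitely many of them intersect in a tail. *)
Lemma nonprincipal_eventually (w : ultrafilter_on nat) (A : set nat) :
  nonprincipal w -> \oo A -> w A.
Proof.
move=> nw [N _ NA].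
have wx (x : nat) : w (~` [set x]).
  have [wx|//] := in_ultra_setVsetC [set x] (ultrafilter_class w).
  case: (nw x); apply/funext => B; apply/propext; split=> [wB _ ->|Bx].
    by have [y [/= -> ]] := filter_ex (filterI wx wB).
  by apply: filterS wx => _ ->; exact: Bx.
have : w [set i | forall x, x \in iota 0 N -> i <> x].
  by apply: filter_seq => // x _; exact: wx.
apply: filterS => i ni; apply: NA => /=; rewrite leqNgt; apply/negP => iN.
by apply: (ni i) => //; rewrite mem_iota.
Qed.

(* If A is not cofinite, then the cofinite filter restricted to its complement
   extends to an ultrafilter that avoids A. *)
Lemma eventually_nonprincipal (A : set nat) :
  (forall w : ultrafilter_on nat, nonprincipal w -> w A) -> \oo A.
Proof.
move=> wA; apply/not_notP => nA.
have PF : ProperFilter (within (~` A) \oo).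
  apply: Build_ProperFilter => -[N _ NA]; apply: nA; exists N => // i Ni.
  by apply: contrapT => nAi; exact: NA Ni nAi.
have [F [UF WF]] := ultraFilterLemma PF.
pose w := UltrafilterOn UF.
have nw : nonprincipal w.
  move=> x wE; have : w (~` [set x]).
    by apply: WF; exists x.+1 => // i /= xi _ ix; rewrite ix ltnn in xi.
  by rewrite wE => wn; exact: (wn x).
have wnA : w (~` A) by apply: WF; exists 0.
have [i [nAi]] := filter_ex (filterI wnA (wA _ nw)); exact: nAi.
Qed.

(** Otherwise the preceding criterion would hold vacuously for the empty set and make it
    cofinite. *)
Lemma nonprincipal_exists : exists w : ultrafilter_on nat, nonprincipal w.
Proof.
apply: contrapT => nw.
have [|N _ /(_ N)] := @eventually_nonprincipal set0; last by apply => /=.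
by move=> w ww; case: nw; exists w.
Qed.

End Filters.

(** * Ultralimits of bounded real and complex families *)

Section UltraLimits.
Context {R : realType} (I : Type) (w : ultrafilter_on I).

(** Compactness of the segment gives a cluster point of the image ultrafilter, and a cluster point
    of an ultrafilter is a limit. *)
Lemma ultra_bounded_cvg (u : I -> R) (M : R) :
  (forall i, `|u i| <= M) -> exists l : R, u i @[i --> (w : set_system I)] --> l.
Proof.
move=> uM; have PF : ProperFilter (u @ (w : set_system I)).
  exact: fmap_proper_filter.
have [|l [_ cl]] := @segment_compact R (- M) M (u @ (w : set_system I)) PF.
  apply: (@filterE _ (w : set_system I)) => i /=.
  by rewrite in_itv /= -ler_norml uM.
exists l => A Al.
have [//|wn] := in_ultra_setVsetC (u @^-1` A) (ultrafilter_class w).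
have [x [nAx Ax]] : (~` A `&` A) !=set0 by exact: cl wn Al.
by have := nAx Ax.
Qed.

Lemma normc_le_ReIm (z : R[i]) : normc z <= `|complex.Re z| + `|complex.Im z|.
Proof.
case: z => x y /=; rewrite -(ler_pXn2r (n := 2)) ?nnegrE ?sqrtr_ge0 ?addr_ge0 //.
rewrite sqr_sqrtr ?addr_ge0 ?sqr_ge0 // sqrrD !real_normK ?num_real //.
by rewrite addrAC lerDl mulrn_wge0 // mulr_ge0.
Qed.

(** Real and imaginary parts converge separately. Convergence is phrased through real distances so
    that estimates on [normc] apply directly. *)
Lemma ultra_bounded_cvgc (z : I -> R[i]) (M : R) :
  (forall i, normc (z i) <= M) ->
  exists l : R[i], normc (z i - l) @[i --> (w : set_system I)] --> (0 : R).
Proof.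
move=> zM.
have ReM i : `|complex.Re (z i)| <= M.
  rewrite (le_trans _ (zM i)) //; case: (z i) => x y /=.
  by rewrite -sqrtr_sqr ler_wsqrtr // lerDl sqr_ge0.
have ImM i : `|complex.Im (z i)| <= M.
  rewrite (le_trans _ (zM i)) //; case: (z i) => x y /=.
  by rewrite -sqrtr_sqr ler_wsqrtr // lerDr sqr_ge0.
have [x zx] := ultra_bounded_cvg ReM; have [y zy] := ultra_bounded_cvg ImM.
exists (Complex x y).
have cx : `|complex.Re (z i) - x| @[i --> (w : set_system I)] --> (0 : R).
  by apply/norm_cvg0P; rewrite -(subrr x); apply: cvgB => //; exact: cvg_cst.
have cy : `|complex.Im (z i) - y| @[i --> (w : set_system I)] --> (0 : R).
  by apply/norm_cvg0P; rewrite -(subrr y); apply: cvgB => //; exact: cvg_cst.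
have c0 : (fun=> 0 : R) @ (w : set_system I) --> (0 : R) by exact: cvg_cst.
have cxy : `|complex.Re (z i) - x| + `|complex.Im (z i) - y|
    @[i --> (w : set_system I)] --> (0 : R).
  by rewrite -(addr0 0); exact: cvgD.
apply: (squeeze_cvgr _ c0 cxy); apply: filterE => i; rewrite normc_ge0 /=.
by apply: le_trans (normc_le_ReIm _) _; case: (z i).
Qed.

Lemma cvgc_lim (z : I -> R[i]) (l : R[i]) :
  normc (z i - l) @[i --> (w : set_system I)] --> (0 : R) ->
  lim ((fun i => z i : R[i]^o) @ (w : set_system I)) = l.
Proof.
move=> zl; apply: cvg_lim; first exact: norm_hausdorff.
apply/cvgrPdist_lt => e e0.
(* A positive element of [R[i]] is a positive real. *)
have /andP[/eqP Ime Ree] : (complex.Im e == 0) && (0 < complex.Re e).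
  by move: e0; rewrite ltcE.
have /cvgrPdist_lt/(_ _ Ree) := zl; apply: filterS => i /=.
rewrite sub0r normrN ger0_norm ?normc_ge0 // => lt1.
have -> : e = (complex.Re e)%:C%C by case: e Ime {e0 Ree lt1} => ? ? /= ->.
by rewrite distrC normc_def ltcR; move: lt1; case: (z i - l).
Qed.

End UltraLimits.

(** * Words and square norms in the ultraproduct *)

Section Ultraproduct.
Context {R : realType} (w : ultrafilter_on nat) (G : nat -> groupType).
Implicit Type f : forall i, G i -> R[i].

Lemma upi_mul (x y : forall i, G i) :
  (upi w x * upi w y)%g = upi w (fun i => x i * y i)%g.
Proof. exact: upiM. Qed.

Lemma upi_inv (x : forall i, G i) :
  (upi w x)^-1%g = upi w (fun i => (x i)^-1)%g.
Proof. exact: upiV. Qed.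

Lemma upi_one : 1%g = upi w (fun i => 1%g : G i).
Proof. by []. Qed.

Lemma upi_exp (x : forall i, G i) n :
  (upi w x ^+ n)%g = upi w (fun i => x i ^+ n)%g.
Proof.
elim: n => [|n IH]; first by rewrite expg0 upi_one.
rewrite expgS IH upi_mul; apply/upiP; apply: filterE => i /=.
by rewrite expgS.
Qed.

Lemma upi_expgz (x : forall i, G i) m :
  expgz (upi w x) m = upi w (fun i => expgz (x i) m).
Proof. by case: m => n /=; rewrite upi_exp // upi_inv. Qed.

Lemma word_val_upi (H : groupType) (psi : forall i, H -> G i)
    (l : seq (H * int)) :
  word_val (fun t => upi w (fun i => psi i t)) l =
  upi w (fun i => word_val (psi i) l).
Proof.
elim: l => [|p l IH].
  by rewrite /word_val big_nil upi_one; apply/upiP/filterE => i; rewrite /= big_nil.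
rewrite word_val_cons IH upi_expgz upi_mul; apply/upiP/filterE => i /=.
by rewrite word_val_cons.
Qed.

(** The instance of Los's theorem for word equations. *)
Lemma word_val_upi1 (H : groupType) (psi : forall i, H -> G i)
    (l : seq (H * int)) :
  word_val (fun t => upi w (fun i => psi i t)) l = 1%g <->
  w [set i | word_val (psi i) l = 1%g].
Proof. by rewrite word_val_upi upi_one; exact: upiP. Qed.

Section BoundedFunctions.
Variables (f : forall i, G i -> R[i]) (a : R).
Arguments f : clear implicits.
Hypothesis f_le : forall i x, normc (f i x) <= a.

Lemma ulim_cvg (x : forall i, G i) :
  normc (f i (x i) - ulim w f (upi w x)) @[i --> (w : set_system nat)] --> (0 : R).
Proof.
have [l fl] := ultra_bounded_cvgc w (fun i => f_le (x i)).
by rewrite ulimE (cvgc_lim fl).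
Qed.

Lemma ulim_near (x : forall i, G i) (e : R) : 0 < e ->
  w [set i | normc (f i (x i) - ulim w f (upi w x)) < e].
Proof.
move=> e0; have /cvgrPdist_lt/(_ _ e0) := ulim_cvg x.
by apply: filterS => i /=; rewrite sub0r normrN ger0_norm ?normc_ge0.
Qed.

Lemma ulim_normc_cvg (x : forall i, G i) :
  normc (f i (x i)) @[i --> (w : set_system nat)] --> normc (ulim w f (upi w x)).
Proof.
apply/cvgrPdist_lt => e e0; apply: filterS (ulim_near x e0) => i /=.
apply: le_lt_trans; rewrite ler_norml; apply/andP; split.
  by rewrite lerNl opprB le_normc_dist.
by rewrite normcBC le_normc_dist.
Qed.

Lemma upi_neq (X Y : ultraprod w G) :
  X <> Y -> w [set i | urepr X i <> urepr Y i].
Proof.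
move=> XY.
have [XYw|//] :=
  in_ultra_setVsetC [set i | urepr X i = urepr Y i] (ultrafilter_class w).
by case: XY; rewrite -(upiK X) -(upiK Y); apply/upiP.
Qed.

(** Fatou's argument: a finite sum over the ultraproduct is the ultralimit of the sums over
    representatives, each bounded by [b] for w-many [i]. *)
Lemma sqnorm2_ulim (b : R) :
  (forall i, sqnorm2 (f i) <= b%:E)%E -> (sqnorm2 (ulim w f) <= b%:E)%E.
Proof.
move=> fb; apply: ge_ereal_sup => _ [A [Afin _] <-].
rewrite fsbig_finite //; set s : seq _ := finmap.enum_fset _.
have us : uniq s by exact: finmap.fset_uniq.
rewrite sumEFin lee_fin.
have cvs : \sum_(X <- s) normc (f i (urepr X i)) ^+ 2
             @[i --> (w : set_system nat)] -->
           \sum_(X <- s) normc (ulim w f X) ^+ 2.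
  apply: cvg_big => [|X _]; first exact: add_continuous.
  have cX := ulim_normc_cvg (x := urepr X); rewrite upiK in cX.
  exact: (cvgM cX cX).
apply: (cvgr_to_le cvs).
(* Representatives of distinct classes differ for w-many [i], so the sum at such an [i] counts no
   group element twice. *)
have inj : w [set i | forall p, p \in [seq (X, Y) | X <- s, Y <- s] ->
    urepr p.1 i = urepr p.2 i -> p.1 = p.2].
  apply: filter_seq => -[X Y] _ /=.
  have [->|/eqP XY] := eqVneq X Y; first exact: filterE.
  by apply: filterS (upi_neq XY) => i /= n /n.
apply: filterS inj => i inj.
rewrite -lee_fin; apply: le_trans (fb i).
have ui : uniq [seq urepr X i | X <- s].
  rewrite map_inj_in_uniq // => X Y Xs Ys.
  by apply: (inj (X, Y)); exact: allpairs_f.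
apply: esum_ge; exists [set` [seq urepr X i | X <- s]].
  by split=> //; exact: finite_seq.
by rewrite -fsbig_seq // big_map sumEFin.
Qed.

End BoundedFunctions.
End Ultraproduct.

(** * Transfer between e-isomorphisms and isomorphism with the ultralimit *)

Section Transfer.
Context {R : realType} (w : ultrafilter_on nat) (G : nat -> groupType).
Variables (f : forall i, G i -> R[i]) (a : R).
Arguments f : clear implicits.
Hypothesis f_le : forall i x, normc (f i x) <= a.
Context {H : groupType} (h : H -> R[i]).
Hypothesis h_l2 : l2 h.

(** Drops the two sets of an e-isomorphism and keeps one total map out of [H], the form in which a
    map can be chosen for every [i]. *)
Lemma eps_iso_map (K : groupType) (k : K -> R[i]) (e : R) :
  eps_iso e h k ->
  exists psi : H -> K,
  [/\ forall l, word_in (supp_eps e h) l -> (size l <= `|Num.ceil e^-1|)%N ->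
        word_val id l = 1%g <-> word_val psi l = 1%g,
      forall t, supp_eps e h t -> normc (h t - k (psi t)) <= e
    & forall x, supp_eps e k x -> exists2 t, psi t = x & normc (h t - k x) <= e].
Proof.
move=> [T [S [psi [/partial_iso_wordP[[_ _ surj] psiP] T1 S1 hpsi]]]].
exists psi; split=> [l wl ln|t et|x /S1/surj[t Tt <-]].
- by apply: psiP => // p /wl[/T1].
- exact/hpsi/T1.
- by exists t => //; exact: hpsi.
Qed.

Lemma isomorphic_ulim (e : nat -> R) :
  (forall i, 0 < e i) -> e i @[i --> (w : set_system nat)] --> (0 : R) ->
  (forall i, eps_iso (e i) (f i) h) -> isomorphic h (ulim w f).
Proof.
move=> e_gt0 e_cvg fh.
have e_lt d : 0 < d -> w [set i | e i < d].
  move=> d0; have /cvgrPdist_lt/(_ _ d0) := e_cvg; apply: filterS => i /=.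
  by rewrite sub0r normrN ger0_norm // ltW.
have X i := cid (eps_iso_map (eps_iso_sym (fh i))).
pose psi i : H -> G i := projT1 (X i).
have psi_word i := let: And3 Y _ _ := projT2 (X i) in Y.
have psi_near i := let: And3 _ Y _ := projT2 (X i) in Y.
have psi_surj i := let: And3 _ _ Y := projT2 (X i) in Y.
rewrite -/(psi _) in psi_word psi_near psi_surj.
pose beta t := upi w (fun i => psi i t).
(* Once [e i] is below the modulus of [h t], the point [t] is in the range of validity of [psi i],
   which keeps the value up to [e i]. *)
have beta_ulim t : supp h t -> ulim w f (beta t) = h t.
  move=> ht; rewrite /beta ulimE; apply: cvgc_lim.
  have c0 : (fun=> 0 : R) @ (w : set_system nat) --> (0 : R) by exact: cvg_cst.
  apply: (squeeze_cvgr _ c0 e_cvg); apply: filterS (e_lt _ ht) => i /= ei.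
  by rewrite normc_ge0 normcBC psi_near.
apply: (@isomorphic_word _ _ _ _ _ beta).
- apply/seteqP; split=> [_ [t ht <-]|Y Ysupp].
    by apply/supp_neq0; rewrite beta_ulim //; apply/supp_neq0.
  (* With [e i < d], the value of [f i] at the representative exceeds [3d] in modulus, so it has a
     partner [t] where [h] exceeds [2d]; thus [t] lies in the finite set [supp_eps d h]. *)
  pose d := normc (ulim w f Y) / 4.
  have d0 : 0 < d by rewrite divr_gt0.
  have d4 : normc (ulim w f Y) = d + d + d + d.
    by rewrite /d -!mulrDl -!mulr2n; field.
  have fin := l2_finite_supp_eps h_l2 d0.
  have wt : w [set i | exists2 t, t \in finmap.enum_fset (fset_set (supp_eps d h))
      & psi i t = urepr Y i].
    have near := ulim_near w f_le (urepr Y) d0.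
    rewrite upiK in near; apply: filterS2 near (e_lt _ d0) => i /= fi ei.
    have fY : d + d + d < normc (f i (urepr Y i)).
      have := le_normc_dist (ulim w f Y) (f i (urepr Y i)).
      by rewrite normcBC d4 => le; lra.
    have [|t psit ht] := psi_surj i (urepr Y i).
      by rewrite /supp_eps /=; lra.
    exists t => //; rewrite in_fset_set // inE /supp_eps /=.
    have := le_normc_dist (f i (urepr Y i)) (h t); by rewrite normcBC => le; lra.
  have [t tF wt'] := ultra_pigeonhole wt.
  move: tF; rewrite in_fset_set // inE /supp_eps /= => ht.
  exists t; first exact: lt_trans ht.
  by rewrite -(upiK Y) /beta; apply/upiP.
- move=> l lh; rewrite word_val_upi1.
  have wl : w [set i | word_val id l = 1%g <-> word_val (psi i) l = 1%g].
    have w1 : w [set i | forall p, p \in l -> e i < normc (h p.1)].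
      by apply: filter_seq => p /lh[hp _]; exact: e_lt.
    (* When [e i] is below this bound, the weight of the e-isomorphism is at least the length of
       [l]. *)
    have s0 : 0 < (size l).+1%:R^-1 :> R by rewrite invr_gt0 ltr0n.
    apply: filterS2 w1 (e_lt _ s0) => i /= w1 ei; apply: psi_word.
      by move=> p pl; have [] := lh p pl; split=> //; exact: w1.
    rewrite -lez_nat gez0_abs; last first.
      by rewrite -(ceil0 R) le_ceil // invr_ge0 ltW.
    rewrite -(ler_int R); apply: le_trans (ceil_ge _).
    rewrite -pmulrn (le_trans (y := (size l).+1%:R)) ?ler_nat //.
    by rewrite -[leLHS]invrK lef_pV2 ?posrE ?e_gt0 // ltW.
  split=> [l1|w1].
    by apply: filterS wl => i /= <-.
  by have [i [[_ /= +] /= li]] := filter_ex (filterI wl w1); apply.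
- by move=> t ht; rewrite beta_ulim.
Qed.

(** A finite alphabet has finitely many words of bounded length. The induction splits off the first
    letter and applies the hypothesis to the predicate on the remaining word. *)
Lemma filter_words (T : set H) (n : nat) (P : seq (H * int) -> set nat) :
  finite_set T ->
  (forall l, word_in T l -> w (P l)) ->
  w [set i | forall l, word_in T l -> (size l <= n)%N -> P l i].
Proof.
move=> fin; elim: n P => [|n IH] P wP.
  have P0 : w (P [::]) by exact: wP.
  by apply: filterS P0 => i P0 [].
pose letters := [seq (t, m) | t <- finmap.enum_fset (fset_set T),
                              m <- [:: -1; 0; 1] : seq int].
have P0 : w (P [::]) by exact: wP.
have Ps : w [set i | forall p, p \in letters ->
    forall l, word_in T l -> (size l <= n)%N -> P (p :: l) i].
  apply: filter_seq => p /allpairsP[[t m] /= [tT m1 ->]].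
  apply: (IH (fun l => P ((t, m) :: l))) => l lT; apply: wP => q.
  rewrite inE => /predU1P[->|/lT//] /=; split=> //.
  by move: tT; rewrite in_fset_set // inE.
apply: filterS2 P0 Ps => i P0 Ps [//|[t m] l] lT ln.
apply: Ps => //.
  have [/= Tt m1] := lT _ (mem_head _ _).
  by apply: allpairs_f => //; rewrite in_fset_set // inE.
by move=> q ql; apply: lT; rewrite inE ql orbT.
Qed.

Lemma ulim_eps_iso (e : R) :
  0 < e -> isomorphic h (ulim w f) -> w [set i | eps_iso e (f i) h].
Proof.
move=> e0 [alpha [[alphaf alpha_inj alpha_surj] alphaM hE]].
(* The threshold is halved because values above [e] only force an ultralimit of modulus at least
   [e], where strictness may be lost. *)
pose T := supp_eps (e / 2) h.
have e2 : 0 < e / 2 by rewrite divr_gt0.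
have fin : finite_set T by exact: l2_finite_supp_eps.
have Tsupp : T `<=` supp h by move=> t; apply: lt_trans.
have Tgen : T `<=` generated (supp h).
  by apply: subset_trans Tsupp _; exact: sub_generated.
have hT t : generated (supp h) t -> h t = ulim w f (alpha t).
  by move=> ht; rewrite hE //; exact/mem_set.
pose s : seq H := finmap.enum_fset (fset_set T).
have sT t : t \in s <-> T t by rewrite in_fset_set // inE.
pose psi i t := urepr (alpha t) i.
have wword : w [set i | forall l, word_in T l ->
    (size l <= `|Num.ceil e^-1|)%N ->
    word_val id l = 1%g <-> word_val (psi i) l = 1%g].
  apply: (@filter_words T _ (fun l =>
    [set i | word_val id l = 1%g <-> word_val (psi i) l = 1%g])) => // l lT.
  have lh : word_in (supp h) l by move=> p /lT[/Tsupp].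
  have gl : generated (supp h) (word_val id l).
    by apply/generated_word; exists l.
  have lE : word_val id l = 1%g <-> w [set i | word_val (psi i) l = 1%g].
    rewrite -word_val_upi1.
    have -> : word_val (fun t => upi w (fun i => psi i t)) l =
              alpha (word_val id l).
      rewrite (morph_generated_word alphaM) //.
      by apply: eq_word_val => p _; exact: upiK.
    split=> [->|al1]; first exact: morph_generated1 alphaM.
    have [g1 _ _] := generated_subgroup (supp h).
    apply: alpha_inj; rewrite ?(morph_generated1 alphaM) //; exact/mem_set.
  (* Triviality of the word in [H] does not depend on [i]; by [lE] it agrees with the alternative
     that [w] selects. *)
  have [w1|nw1] := in_ultra_setVsetC [set i | word_val (psi i) l = 1%g]
    (ultrafilter_class w).
    by apply: (filterS _ w1) => i /= ->; split=> // _; apply/lE.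
  apply: (filterS _ nw1) => i /= nl; split=> // /lE w1.
  by have [j []] := filter_ex (filterI nw1 w1).
have winj : w [set i | forall p, p \in [seq (t, u) | t <- s, u <- s] ->
    psi i p.1 = psi i p.2 -> p.1 = p.2].
  apply: filter_seq => _ /allpairsP[[t u] [/sT Tt /sT Tu ->]] /=.
  have [->|/eqP tu] := eqVneq t u; first exact: filterE.
  have atu : alpha t <> alpha u.
    by move=> /alpha_inj atu; apply/tu/atu; apply/mem_set; exact: Tgen.
  by apply: filterS (upi_neq atu) => i /= n /n.
have wnear : w [set i | forall t, t \in s -> normc (f i (psi i t) - h t) < e].
  apply: filter_seq => t /sT Tt; have := ulim_near w f_le (urepr (alpha t)) e0.
  by rewrite upiK -hT //; exact: Tgen.
have wsupp : w [set i | supp_eps e (f i) `<=` psi i @` T].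
  have [//|nw] := in_ultra_setVsetC [set i | supp_eps e (f i) `<=` psi i @` T]
    (ultrafilter_class w).
  (* If the inclusion failed for w-many [i], the points violating it, with 1 as filler elsewhere,
     would define an element of the ultraproduct. *)
  have Y i : {y | ~ (supp_eps e (f i) `<=` psi i @` T) ->
      e < normc (f i y) /\ ~ (psi i @` T) y}.
    apply: cid; have [|ns] := pselect (supp_eps e (f i) `<=` psi i @` T).
      by exists 1%g.
    apply: contrapT => nY; apply: ns => y ey; apply: contrapT => ny.
    by apply: nY; exists y.
  pose y i := projT1 (Y i).
  have wy : w [set i | e < normc (f i (y i)) /\ ~ (psi i @` T) (y i)].
    by apply: filterS nw => i; exact: (projT2 (Y i)).
  have ley : e <= normc (ulim w f (upi w y)).
    apply: (cvgr_to_ge (ulim_normc_cvg (w := w) f_le (x := y))).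
    by apply: filterS wy => i [/ltW].
  (* This class is [alpha t] for some [t] in [T], so [psi i t = y i] for w-many [i], against the
     choice of [y]. *)
  have /sub_generated/alpha_surj[t gt ty] : supp (ulim w f) (upi w y).
    exact: lt_le_trans ley.
  have Tt : T t.
    rewrite /T /supp_eps /= hT // ty (lt_le_trans _ ley) //.
    by rewrite ltr_pdivrMr // ltr_pMr // ltr1n.
  have wt : w [set i | psi i t = y i] by apply/upiP; rewrite upiK.
  have [i [[_ ny] /= ti]] := filter_ex (filterI wy wt).
  by case: ny; exists t.
apply: filterS2 (filterI wword winj) (filterI wnear wsupp).
move=> i [/= iword iinj] [/= inear isupp]; apply: eps_iso_sym.
exists T, (psi i @` T), (psi i); split=> //.
- apply/partial_iso_wordP; split=> //; split=> //.
  move=> t u /set_mem Tt /set_mem Tu.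
  by apply: (iinj (t, u)); apply: allpairs_f; exact/sT.
- move=> t; apply: lt_trans; by rewrite ltr_pdivrMr // ltr_pMr // ltr1n.
- by move=> t Tt; rewrite normcBC ltW //; apply: inear; exact/sT.
Qed.

End Transfer.

(** * Convergence in [dhat] and independence of the ultrafilter *)

Unset Implicit Arguments.

Theorem theorem7p1 (R : realType) (a : R) (G : nat -> groupType)
    (f : forall i, G i -> R[i]) (a_gt0 : 0 < a)
    (f_l2 : forall i, l2 (f i)) (f_le_a : forall i, norm2 (f i) <= a) :
  (forall (H : groupType) (h : H -> R[i]),
     l2 h -> (fun i => dhat (f i) h) @ \oo --> (0 : R) ->
     forall w : ultrafilter_on nat, nonprincipal w -> isomorphic h (ulim w f)) /\
  ((exists (H : groupType) (h : H -> R[i]),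
      l2 h /\ (fun i => dhat (f i) h) @ \oo --> (0 : R)) <->
   (forall w w' : ultrafilter_on nat, nonprincipal w -> nonprincipal w' ->
      isomorphic (ulim w f) (ulim w' f))).
Proof.
have f_le i x : normc (f i x) <= a := le_trans (l2_normc_le x (f_l2 i)) (f_le_a i).
have iso_lim (H : groupType) (h : H -> R[i]) : l2 h ->
    (fun i => dhat (f i) h) @ \oo --> (0 : R) ->
    forall w : ultrafilter_on nat, nonprincipal w -> isomorphic h (ulim w f).
  move=> h_l2 fh w ww.
  (* The infimum [dhat] may be 0 or not attained; adding a null sequence of positive terms gives
     admissible values that still tend to 0. *)
  have gt0 i : 0 < dhat (f i) h + i.+1%:R^-1.
    by rewrite ltr_wpDl ?dhat_ge0 // invr_gt0 ltr0n.
  apply: (isomorphic_ulim f_le h_l2 gt0).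
    have c : dhat (f i) h + i.+1%:R^-1 @[i --> \oo] --> (0 : R).
      by rewrite -(addr0 0); apply: cvgD => //; exact: cvg_harmonic.
    by move=> A /c cA; exact: nonprincipal_eventually.
  move=> i; apply: eps_iso_dhat => //.
  by rewrite ltrDl invr_gt0 ltr0n.
split=> //; split=> [[H [h [h_l2 fh]]] w w' ww ww'|iso].
  apply: (isomorphic_trans (f2 := h)); last exact: iso_lim.
  by apply: isomorphic_sym; exact: iso_lim.
have [w ww] := nonprincipal_exists.
have sqf i : (sqnorm2 (f i) <= (a ^+ 2)%:E)%E.
  have ge0 : (0 <= sqnorm2 (f i))%E.
    by apply: esum_ge0 => x _; rewrite lee_fin exprn_ge0 ?normc_ge0.
  have fin : sqnorm2 (f i) \is a fin_num by rewrite ge0_fin_numE //; exact: f_l2.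
  rewrite -(fineK fin) lee_fin -(sqr_sqrtr (fine_ge0 ge0)).
  by rewrite ler_pXn2r ?nnegrE ?sqrtr_ge0 ?(ltW a_gt0) //; exact: f_le_a.
have h_l2 : l2 (ulim w f).
  by rewrite /l2 /=; apply: le_lt_trans (sqnorm2_ulim w f_le sqf) _; rewrite ltry.
exists (ultraprod w G : groupType), (ulim w f); split=> //.
apply/cvgrPdist_le => e e0.
(* It suffices to find e-isomorphisms for almost all [i]. Each non-principal [w'] sees them, since
   [ulim w f] is isomorphic to [ulim w' f]. *)
suff near : \oo [set i | eps_iso e (f i) (ulim w f)].
  apply: filterS near => i /= fe.
  by rewrite sub0r normrN ger0_norm ?dhat_ge0 ?dhat_le.
apply: eventually_nonprincipal => w' ww'.
by apply: (ulim_eps_iso f_le h_l2 e0); exact: iso.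
Qed.
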